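(* Let $A=(a_{ij})$ be an $N\times N$ matrix with real entries, let $\epsilon,\phi\in\mathbb{R}$, and let $\theta_0=(\theta_1,\dots,\theta_N)\in\mathbb{R}^N$. Suppose that $x_0=e^{\mathbf{i}\theta_0}=(e^{\mathbf{i}\theta_1},\dots,e^{\mathbf{i}\theta_N})^T$ is an eigenvector of $A$ associated with the eigenvalue $\lambda\in\mathbb{C}$. Suppose further that $\lambda e^{-\mathbf{i}\phi}\in\mathbb{R}$. Then $\theta_0$ is an equilibrium point of the phase-lag complex-valued model $$\frac{d\theta_i}{dt}=\epsilon\sum_{j=1}^N a_{ij}\left(\sin(\theta_j-\theta_i-\phi)-\mathbf{i}\cos(\theta_j-\theta_i-\phi)\right),\qquad 1\le i\le N.$$
   Context: Here $\mathbf{i}=\sqrt{-1}$, and exponentials and arguments of vectors are taken entrywise. In the phase-lag complex-valued model $\theta_i\in\mathbb{C}$; under $x=e^{\mathbf{i}\theta}$ it becomes the linear system $\frac{dx}{dt}=\epsilon e^{-\mathbf{i}\phi}Ax$, whose solution is $x(t)=e^{\epsilon e^{-\mathbf{i}\phi}At}x(0)$. A real vector $\theta_0$ is called an equilibrium point of this model if, with $x_0=e^{\mathbf{i}\theta_0}$, for all $t\ge0$ one has $\arg(e^{\epsilon e^{-\mathbf{i}\phi}At}x_0)=\arg(x_0)=\theta_0$, where arguments are understood modulo $2\pi$ (in particular every entry of $e^{\epsilon e^{-\mathbf{i}\phi}At}x_0$ is nonzero). *)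

(* Defs.v *)
From HB Require Import structures.
From mathcomp Require Import all_boot all_order all_algebra.
From mathcomp Require Import all_classical all_reals all_analysis.
From mathcomp Require Import complex ring.

Set Implicit Arguments.
Unset Strict Implicit.
Unset Printing Implicit Defensive.

Import Order.TTheory GRing.Theory Num.Theory.
Import numFieldNormedType.Exports.

Local Open Scope classical_set_scope.
Local Open Scope ring_scope.
Local Open Scope complex_scope.

Definition cexp (R : realType) (z : R[i]) : R[i] :=
  let: a +i* b := z in (expR a * cos b) +i* (expR a * sin b).

Definition csin (R : realType) (z : R[i]) : R[i] :=
  (cexp ('i * z) - cexp (- ('i * z))) / (2 * 'i).

Definition ccos (R : realType) (z : R[i]) : R[i] :=
  (cexp ('i * z) + cexp (- ('i * z))) / 2.

(* Multivalued argument (a coset of 2 pi Z when z != 0), so that equality of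
   arguments modulo 2 pi is equality of sets; 0 has no argument. *)
Definition arg (R : realType) (z : R[i]) : set R :=
  [set th | z != 0 /\ z = `|z| * cexp ('i * th%:C)].

(* Exponential series, for the entrywise topology on matrices. *)
Definition expmx (R : realType) (N : nat) (M : 'M[R[i]]_N) : 'M[R[i]]_N :=
  lim (series (fun k => (k`!%:R : R[i])^-1 *: M ^+ k) @ \oo).

(* Column eigenvectors; the library's [eigenspace] is about row vectors. *)
Definition eigenvector (F : fieldType) (N : nat) (A : 'M[F]_N) (lambda : F)
    (x : 'cV[F]_N) : Prop :=
  x != 0 /\ A *m x = lambda *: x.

Definition complex_mx (R : realType) (m n : nat) (A : 'M[R]_(m, n)) :
    'M[R[i]]_(m, n) :=
  map_mx (fun a => a%:C) A.

Definition phase_vec (R : realType) (N : nat) (theta : 'cV[R[i]]_N) :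
    'cV[R[i]]_N :=
  map_mx (fun th => cexp ('i * th)) theta.

(* The model is d theta/dt = phase_lag_field A eps phi theta, theta complex. *)
Definition phase_lag_field (R : realType) (N : nat) (A : 'M[R]_N)
    (eps phi : R) (theta : 'cV[R[i]]_N) : 'cV[R[i]]_N :=
  \col_i (eps%:C * \sum_j (A i j)%:C *
    (csin (theta j 0 - theta i 0 - phi%:C)
     - 'i * ccos (theta j 0 - theta i 0 - phi%:C))).

(* x = phase_vec theta turns the model into dx/dt = phase_lag_mx A eps phi *m x
   (phase_lag_linearization below). *)
Definition phase_lag_mx (R : realType) (N : nat) (A : 'M[R]_N)
    (eps phi : R) : 'M[R[i]]_N :=
  (eps%:C * cexp (- ('i * phi%:C))) *: complex_mx A.

Lemma cexpD (R : realType) (z w : R[i]) : cexp (z + w) = cexp z * cexp w.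
Proof.
case: z w => [a b] [c d]; apply/eqP.
by rewrite eq_complex /= expRD cosD sinD; apply/andP; split; apply/eqP; ring.
Qed.

Lemma csin_ccos (R : realType) (z : R[i]) :
  'i * (csin z - 'i * ccos z) = cexp ('i * z).
Proof.
have i2 : ('i : R[i]) * 'i = -1.
  apply/eqP; rewrite eq_complex /=.
  by rewrite !(mul0r, mulr0, mul1r, sub0r, addr0, oppr0) !eqxx.
have i0 : ('i : R[i]) != 0 by rewrite eq_complex /= oner_eq0 andbF.
have n2 : (2 : R[i]) != 0 by rewrite pnatr_eq0.
rewrite /csin /ccos; set u := cexp _; set v := cexp _.
have -> : 'i * ((u - v) / (2 * 'i) - 'i * ((u + v) / 2)) =
    (2^-1 * ('i * 'i^-1)) * (u - v) - ('i * 'i) * ((u + v) * 2^-1).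
  by rewrite invfM; ring.
rewrite i2 divff // mulr1 mulN1r opprK.
have -> : 2^-1 * (u - v) + (u + v) * 2^-1 = u * (2 * 2^-1) by ring.
by rewrite divff // mulr1.
Qed.

(* Chain rule: along d theta/dt = phase_lag_field theta, the derivative
   i x_k (d theta_k/dt) of x_k = e^(i theta_k) is the k-th entry of
   phase_lag_mx *m x. *)
Lemma phase_lag_linearization (R : realType) (N : nat) (A : 'M[R]_N)
    (eps phi : R) (theta : 'cV[R[i]]_N) (k : 'I_N) :
  'i * phase_vec theta k 0 * phase_lag_field A eps phi theta k 0 =
  (phase_lag_mx A eps phi *m phase_vec theta) k 0.
Proof.
have cexpNK : cexp (- ('i * phi%:C)) * cexp ('i * phi%:C) = 1.
  by rewrite -cexpD addNr /cexp /= expR0 cos0 sin0 mulr1 mulr0.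
rewrite -scalemxAl !mxE mulr_sumr mulr_sumr mulr_sumr.
apply: eq_bigr => j _; rewrite !mxE; set w := theta j 0 - _ - _.
have -> : cexp ('i * theta j 0) =
    cexp ('i * theta k 0) * cexp ('i * phi%:C) * cexp ('i * w).
  by rewrite -!cexpD; congr cexp; rewrite /w; ring.
rewrite -(csin_ccos w).
rewrite [RHS](_ : _ = cexp (- ('i * phi%:C)) * cexp ('i * phi%:C) *
  ('i * cexp ('i * theta k 0) *
   (eps%:C * ((A k j)%:C * (csin w - 'i * ccos w))))); last by ring.
by rewrite cexpNK mul1r.
Qed.

Definition phase_lag_solution (R : realType) (N : nat) (A : 'M[R]_N)
    (eps phi : R) (x0 : 'cV[R[i]]_N) (t : R) : 'cV[R[i]]_N :=
  expmx (t%:C *: phase_lag_mx A eps phi) *m x0.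

(* Only the phases stay constant: phase_lag_field need not vanish at an
   equilibrium point, since the moduli of the entries of x may vary. *)
Definition phase_lag_equilibrium (R : realType) (N : nat) (A : 'M[R]_N)
    (eps phi : R) (theta0 : 'cV[R]_N) : Prop :=
  let x0 := phase_vec (complex_mx theta0) in
  forall t : R, 0 <= t -> forall k : 'I_N,
    arg (phase_lag_solution A eps phi x0 t k 0) = arg (x0 k 0)
    /\ arg (x0 k 0) (theta0 k 0).

(* Main.v *)
(* Since x_0 is an eigenvector of the system matrix, for the eigenvalue
   eps e^(-i phi) lambda, which is real, the exponential of t times this matrix
   multiplies x_0 by a positive real number, so no argument changes. *)
Require Import Defs.
From mathcomp Require Import all_boot all_order all_algebra.
From mathcomp Require Import all_classical all_reals all_analysis.
From mathcomp Require Import complex.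
Import Order.TTheory GRing.Theory Num.Theory.
Import numFieldNormedType.Exports.
Local Open Scope classical_set_scope.
Local Open Scope ring_scope.
Local Open Scope complex_scope.

(* The topology is attached to [Num.NumField.sort]; it is not inferred from
   [R[i]] itself. *)
Local Notation C R := (Num.NumField.sort (R[i] : numFieldType)).

Lemma cvg_real_complex (R : realType) (u : nat -> R) (l : R) :
  u @ \oo --> l -> (fun n => (u n)%:C : C R) @ \oo --> (l%:C : C R).
Proof.
move=> ul; apply/cvgrPdist_lt => e e0.
(* In the order of [R[i]], a positive [e] is real, so the radius of a complex ball comes from a real
   one. *)
have eE : e = (complex.Re e)%:C by rewrite RRe_real // gtr0_real.
have Re0 : 0 < complex.Re e by rewrite eE ltcR in e0.
move/cvgrPdist_lt: ul => /(_ _ Re0); apply: filterS => n.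
rewrite eE -rmorphB /= normc_def /= expr0n addr0 sqrtr_sqr ltcR.
exact.
Qed.

Lemma is_cvg_complex (R : realType) (u : nat -> C R) :
  cvgn (fun n => complex.Re (u n)) -> cvgn (fun n => complex.Im (u n)) -> cvgn u.
Proof.
move=> /cvg_ex[a ua] /cvg_ex[b ub]; apply/cvg_ex; exists (a%:C + 'i * b%:C).
rewrite (_ : u = fun n => (complex.Re (u n))%:C + 'i * (complex.Im (u n))%:C); last first.
  by apply/funext => n; exact: complexE.
apply: cvgD; first exact: cvg_real_complex.
by apply: cvgM; [exact: cvg_cst|exact: cvg_real_complex].
Qed.

(** Real and imaginary parts are additive and bounded by the modulus, so each part of the series
    converges absolutely by comparison with [v] on the real line. *)
Lemma is_cvg_series_complex (R : realType) (u : nat -> C R) (v : nat -> R) :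
  (forall n, `|u n| <= (v n)%:C) -> cvgn (series v) -> cvgn (series u).
Proof.
move=> uv cv.
have v0 n : 0 <= v n by rewrite -ler0c (le_trans _ (uv n)).
have part (f : {additive R[i] -> R}) :
    (forall z, `|f z|%:C <= `|z|) -> cvgn (fun n => f (series u n)).
  move=> fle.
  rewrite (_ : (fun n => _) = series (f \o u)); last first.
    by apply/funext => n; rewrite /series /= raddf_sum.
  apply: normed_cvg; apply: (series_le_cvg _ v0 _ cv) => n //=.
  by rewrite -lecR; exact: le_trans (fle (u n)) (uv n).
apply: is_cvg_complex.
  exact: (part (@complex.Re R : {additive _ -> _}) (@normc_ge_Re R)).
apply: (part (@complex.Im R : {additive _ -> _})) => z.
by rewrite normc_def lecR -sqrtr_sqr ler_wsqrtr // lerDr sqr_ge0.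
Qed.

(** The sum of all entry moduli dominates every row sum, so each further factor of [M] multiplies
    the entrywise bound by at most that constant. This gives a geometric bound without a matrix
    norm. *)
Lemma normr_exprmx_le (R : numDomainType) (N : nat) (M : 'M[R]_N) (k : nat)
    (i j : 'I_N) :
  `|(M ^+ k) i j| <= (\sum_a \sum_b `|M a b|) ^+ k.
Proof.
set c := \sum_a _; elim: k i => [|k IHk] i.
  by rewrite !expr0 mxE; case: eqP; rewrite ?normr1 ?normr0.
rewrite !exprS -mulmxE mxE (le_trans (ler_norm_sum _ _ _)) //.
have c0 : 0 <= c by do 2 apply: sumr_ge0 => ? _.
apply: (@le_trans _ _ ((\sum_b `|M i b|) * c ^+ k)).
  by rewrite mulr_suml ler_sum // => l _; rewrite normrM ler_wpM2l.
rewrite ler_wpM2r ?exprn_ge0 // /c [leRHS](bigD1 i) //= lerDl.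
by do 2 apply: sumr_ge0 => ? _.
Qed.

Lemma is_cvg_mx (K : numFieldType) (m n : nat) (u : nat -> 'M[K]_(m, n)) :
  (forall i j, cvgn (fun k => u k i j)) -> cvgn u.
Proof.
move=> cu; apply/cvg_ex.
exists (\matrix_(i, j) lim ((fun k => u k i j) @ \oo)).
(* A neighbourhood of a matrix contains a box: all matrices whose entries lie in given
   neighbourhoods [P i j]. The finitely many entries are eventually all inside. *)
move=> A [P nP PA].
have : \forall k \near \oo, forall i j, P i j (u k i j).
  apply: filter_forall => i; apply: filter_forall => j.
  by apply: (cu i j); have := nP i j; rewrite mxE.
by apply: filterS => k; exact: PA.
Qed.

Lemma cvg_bigsum (K : numFieldType) (V : normedModType K) (T I : Type)
    (F : set_system T) (FF : Filter F) (r : seq I) (P : pred I)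
    (f : I -> T -> V) (l : I -> V) :
  (forall i, P i -> f i @ F --> l i) ->
  (fun t => \sum_(i <- r | P i) f i t) @ F --> \sum_(i <- r | P i) l i.
Proof.
move=> fl; elim: r => [|i r IHr].
  by rewrite big_nil; under eq_fun do rewrite big_nil; exact: cvg_cst.
rewrite big_cons; under eq_fun do rewrite big_cons.
by case: ifPn => // /fl fil; exact: cvgD.
Qed.

Lemma real_complex_exp_coeff (R : realType) (x : R) (k : nat) :
  (exp_coeff x k)%:C = (k`!%:R)^-1 * x%:C ^+ k :> R[i].
Proof. by rewrite exp_coeffE rmorphM fmorphV rmorph_nat rmorphXn. Qed.

(** [expmx] is a [lim], so it can be computed with only once its series converges. Each entry is
    dominated by the real exponential series at the sum of the entry moduli of [M]. *)
Lemma is_cvg_expmx (R : realType) (N : nat) (M : 'M[R[i]]_N) :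
  cvgn (series (fun k => (k`!%:R : R[i])^-1 *: M ^+ k)).
Proof.
apply: is_cvg_mx => i j.
rewrite (_ : (fun k => _) = series (fun k => (k`!%:R)^-1 * (M ^+ k) i j)).
  set c : R[i] := \sum_a \sum_b `|M a b|.
  have c0 : 0 <= c by do 2 apply: sumr_ge0 => ? _.
  have cE : c = (complex.Re c)%:C by rewrite RRe_real // ger0_real.
  apply: is_cvg_series_complex (is_cvg_series_exp_coeff (complex.Re c)) => k.
  rewrite real_complex_exp_coeff -cE.
  rewrite normrM normfV normr_nat ler_wpM2l ?invr_ge0 ?ler0n //.
  exact: normr_exprmx_le.
by apply/funext => k; rewrite /series /= summxE; apply: eq_bigr => l _; rewrite mxE.
Qed.

Lemma expmx_eigenvector (R : realType) (N : nat) (M : 'M[R[i]]_N) (mu : R)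
    (x : 'cV[R[i]]_N) :
  M *m x = mu%:C *: x -> expmx M *m x = (expR mu)%:C *: x.
Proof.
move=> Mx.
have Mkx k : M ^+ k *m x = mu%:C ^+ k *: x.
  elim: k => [|k IHk]; first by rewrite !expr0 mul1mx scale1r.
  by rewrite !exprSr -mulmxE -mulmxA Mx -scalemxAr IHk scalerA mulrC.
apply/colP => i; rewrite !mxE.
pose S := series (fun k => (k`!%:R : R[i])^-1 *: M ^+ k).
(* Entry [i] of [S n *m x] has two limits, equal by uniqueness: [l1] from the entrywise convergence
   of [S], [l2] because [M ^+ k] acts on [x] as [mu ^+ k], which turns [S n] into a partial sum of
   the real exponential series. *)
have l1 : (fun n => (S n *m x) i 0 : C R) @ \oo -->
    (\sum_j expmx M i j * x j 0 : C R).
  rewrite (_ : (fun n => _) = fun n => \sum_j S n i j * x j 0); last first.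
    by apply/funext => n; rewrite mxE.
  apply: cvg_bigsum => j _; apply: cvgM; last exact: cvg_cst.
  exact: (cvg_comp _ _ (@is_cvg_expmx _ _ M)
    (@coord_continuous (R[i] : numFieldType) _ _ i j (expmx M))).
have l2 : (fun n => (S n *m x) i 0 : C R) @ \oo --> ((expR mu)%:C * x i 0 : C R).
  rewrite (_ : (fun n => _) = fun n => (series (exp_coeff mu) n)%:C * x i 0).
    apply: cvgM; last exact: cvg_cst.
    apply: cvg_real_complex; exact: is_cvg_series_exp_coeff.
  apply/funext => n; rewrite /S /series /= mulmx_suml summxE rmorph_sum mulr_suml.
  apply: eq_bigr => k _; rewrite -scalemxAl Mkx !mxE mulrA; congr (_ * _).
  by rewrite [RHS]real_complex_exp_coeff.
exact: (cvg_unique _ l1 l2).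
Qed.

(** As [r] is positive, the modulus of the product is [r] times that of [z], and [r] cancels in the
    equation defining [arg]. *)
Lemma arg_pscale (R : realType) (r : R) (z : R[i]) :
  0 < r -> arg (r%:C * z) = arg z.
Proof.
move=> r0; have rC0 : 0 < r%:C by rewrite ltcR.
rewrite /arg; apply/funext => th; apply/propext => /=.
rewrite mulf_eq0 (gt_eqF rC0) normrM gtr0_norm // -mulrA.
by split=> -[z0 zE]; split=> //; [apply: (mulfI (lt0r_neq0 rC0))|rewrite -zE].
Qed.

Lemma arg_cexp (R : realType) (th : R) : arg (cexp ('i * th%:C)) th.
Proof.
have norm1 : `|cexp ('i * th%:C)| = 1.
  rewrite normc_def /= !(mul0r, mulr0, mul1r, subr0, add0r, addr0).
  by rewrite oppr0 expR0 !mul1r cos2Dsin2 sqrtr1.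
by split; rewrite ?norm1 ?mul1r // -normr_eq0 norm1 oner_eq0.
Qed.

Theorem proposition6 (R : realType) (N : nat) (A : 'M[R]_N) (eps phi : R)
    (theta0 : 'cV[R]_N) (lambda : R[i])
    (Ax0 : eigenvector (complex_mx A) lambda (phase_vec (complex_mx theta0)))
    (lambda_phi : lambda * cexp (- ('i * phi%:C)) \is Num.real) :
  phase_lag_equilibrium A eps phi theta0.
Proof.
move=> t _ k; split; last by rewrite !mxE; exact: arg_cexp.
(* [mu] is lambda e^(-i phi) as a real number. Then [t * eps * mu] is the eigenvalue at x_0 of [t]
   times the system matrix, and its exponential is positive whatever its sign. *)
have /complex_realP[mu muE] := lambda_phi.
have [_ Ax] := Ax0.
rewrite /phase_lag_solution.
rewrite (@expmx_eigenvector _ _ _ (t * eps * mu)) ?mxE.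
  by rewrite arg_pscale // expR_gt0.
have -> : (t * eps * mu)%:C = t%:C * eps%:C * mu%:C by rewrite !rmorphM.
rewrite /phase_lag_mx -!scalemxAl Ax !scalerA -muE -!mulrA.
by rewrite [lambda * _]mulrC.
Qed.
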